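(* Let $q$ be an odd prime power and $k\geq 2$ an integer. Then no subset of $3k-6$ points of a normal rational curve of $\mathrm{PG}_{k-1}(\mathbb{F}_q)$ is contained in an arc of $\mathrm{PG}_{k-1}(\mathbb{F}_q)$ of size $q+2$.
   Context: A normal rational curve of $\mathrm{PG}_{k-1}(\mathbb{F}_q)$ is, up to a change of basis, the set of $q+1$ points spanned by the vectors $(1,t,t^2,\ldots,t^{k-1})$, $t\in\mathbb{F}_q$, together with $(0,\ldots,0,1)$. An arc of $\mathrm{PG}_{k-1}(\mathbb{F}_q)$ is a set of points such that any $k$ of them span the whole space. *)

(* Defs.v *)
From HB Require Import structures.
From mathcomp Require Import all_boot all_order all_algebra.

Set Implicit Arguments.
Unset Strict Implicit.
Unset Printing Implicit Defensive.

Import GRing.Theory.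
Local Open Scope ring_scope.

(* [pg_point F k] is the point set of PG_{k-1}(F): the index is the vector
   space dimension k, not the projective dimension. *)
Record pg_point (F : finFieldType) (k : nat) := PgPoint {
  pg_line :> {vspace 'rV[F]_k};
  pg_line_dim : \dim pg_line == 1%N
}.

HB.instance Definition _ (F : finFieldType) (k : nat) :=
  [isSub for @pg_line F k].
HB.instance Definition _ (F : finFieldType) (k : nat) :=
  [Choice of pg_point F k by <:].

Definition pg_vectors (F : finFieldType) (k : nat) (P : pg_point F k) :
    {set 'rV[F]_k} :=
  [set v | v \in pg_line P].

Definition pg_span (F : finFieldType) (k : nat) (A : {set 'rV[F]_k}) :
    option (pg_point F k) :=
  insub <<enum A>>%VS.

Lemma pg_vectorsK (F : finFieldType) (k : nat) :
  pcancel (@pg_vectors F k) (@pg_span F k).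
Proof.
move=> P; rewrite /pg_span.
suff -> : <<enum (pg_vectors P)>>%VS = pg_line P by rewrite valK.
apply/eqP; rewrite eqEsubv; apply/andP; split.
  by apply/span_subvP => v; rewrite mem_enum inE.
by apply/subvP => v vP; apply: memv_span; rewrite mem_enum inE.
Qed.

HB.instance Definition _ (F : finFieldType) (k : nat) :=
  Choice_isCountable.Build (pg_point F k) (pcan_pickleK (@pg_vectorsK F k)).
HB.instance Definition _ (F : finFieldType) (k : nat) :=
  isFinite.Build (pg_point F k) (pcan_enumP (@pg_vectorsK F k)).

Definition is_arc (F : finFieldType) (k : nat)
    (A : {set pg_point F k}) : Prop :=
  forall S : {set pg_point F k}, S \subset A -> #|S| = k ->
    (\sum_(P in S) pg_line P)%VS = fullv.

(* [None] is the parameter at infinity. *)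
Definition nrc_vec (F : finFieldType) (k : nat) (t : option F) : 'rV[F]_k :=
  if t is Some a then \row_(j < k) a ^+ j
  else \row_(j < k) (j == k.-1 :> nat)%:R.

Definition nrc_of (F : finFieldType) (k : nat) (g : 'M[F]_k) :
    {set pg_point F k} :=
  [set P : pg_point F k |
    [exists t : option F, pg_line P == <[nrc_vec k t *m g]>%VS]].

Definition normal_rational_curve (F : finFieldType) (k : nat)
    (C : {set pg_point F k}) : Prop :=
  exists2 g : 'M[F]_k, g \in unitmx & C = nrc_of g.

(* Main.v *)
Require Import Defs.
From mathcomp Require Import all_boot all_order all_fingroup all_algebra all_solvable all_field.
From mathcomp Require Import ring zify.

(** Let [A] be an arc of size [q + 2] containing a set [G] of [3k - 6] points of
    the curve, and put [t = k - 3].  The hyperplanes through a [(k-2)]-subset [B]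
    of [G] form a projective line, on which the points of [G] outside [B] have
    their curve parameters as coordinates.  Exactly [t] of these hyperplanes miss
    [A] outside [B]; let [h_B] be the form of degree [t] with these roots.
    For a fixed [t]-subset [D] of [G], Segre's lemma of tangents reads
    [h_Dx(y) h_Dy(z) h_Dz(x) = - h_Dx(z) h_Dz(y) h_Dy(x)], so that, after
    rescaling, [h_Dx(y) = - h_Dy(x)] for [x <> y] in [G \ D].  Interpolating in
    both variables on two disjoint [(t+1)]-subsets of [G \ D] avoiding [x] gives
    [h_Dx(x) = - h_Dx(x)], hence [h_Dx(x) = 0] as [q] is odd.  Thus [h_B] has
    degree [t] and vanishes at the [t + 1] points of [B], which is absurd. *)

Set Implicit Arguments.
Unset Strict Implicit.
Unset Printing Implicit Defensive.

Import GRing.Theory.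

(** * Binary forms on the projective line over a finite field *)

Section BinaryForms.
Local Open Scope ring_scope.
Variable F : finFieldType.
Implicit Types (c d : option F) (p q : {poly F}).

(* Polynomials of degree at most [n] stand for binary forms of degree [n], and
   [option F] for the projective line with [None] at infinity: [pev n] evaluates
   such a form, and [plin c] is the linear form vanishing at [c], with signs
   making [br] antisymmetric. *)
Definition pev (n : nat) (p : {poly F}) (c : option F) : F :=
  if c is Some a then p.[a] else p`_n.

Definition plin (c : option F) : {poly F} :=
  if c is Some a then 'X - a%:P else -1.

Definition br (c d : option F) : F := pev 1 (plin c) d.

Lemma brE c d : br c d =
  match c, d with
  | Some a, Some b => b - a
  | Some _, None => 1
  | None, Some _ => -1
  | None, None => 0
  end.
Proof.
case: c d => [a|] [b|]; rewrite /br /= ?hornerE ?coefE //.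
by rewrite subr0.
by rewrite oppr0.
Qed.

Lemma brC c d : br c d = - br d c.
Proof. by rewrite !brE; case: c d => [a|] [b|]; rewrite ?opprB ?oppr0 ?opprK. Qed.

Lemma br_eq0 c d : (br c d == 0) = (c == d).
Proof.
rewrite brE; case: c d => [a|] [b|]; rewrite ?oppr_eq0 ?oner_eq0 ?eqxx //.
by rewrite subr_eq0 eq_sym.
Qed.

(** [br] is the determinant of the vectors [(1, a)] and [(1, b)], with [(0, 1)] at infinity, so this
    is the Plücker relation. *)
Lemma br_plucker c d (y z : option F) :
  br c y * br d z - br d y * br c z = br c d * br y z.
Proof. by rewrite !brE; case: c d y z => [?|] [?|] [?|] [?|]; ring. Qed.

Lemma plin_neq0 c : plin c != 0.
Proof.
by case: c => [a|] /=; [rewrite polyXsubC_eq0 | rewrite oppr_eq0 oner_eq0].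
Qed.

Lemma size_plin c : (size (plin c) <= 2)%N.
Proof. by case: c => [a|] /=; rewrite ?size_XsubC // size_polyN size_poly1. Qed.

Lemma pevB n p q c : pev n (p - q) c = pev n p c - pev n q c.
Proof. by case: c => [a|] /=; rewrite ?hornerE ?coefE. Qed.

Lemma pevZ n a p c : pev n (a *: p) c = a * pev n p c.
Proof. by case: c => [b|] /=; rewrite ?hornerE ?coefE. Qed.

Lemma pev_sum n (I : finType) (P : pred I) (f : I -> {poly F}) c :
  pev n (\sum_(i | P i) f i) c = \sum_(i | P i) pev n (f i) c.
Proof. by case: c => [b|] /=; rewrite ?horner_sum ?coef_sum. Qed.

Lemma pevM m n p q c : (size p <= m.+1)%N -> (size q <= n.+1)%N ->
  pev (m + n) (p * q) c = pev m p c * pev n q c.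
Proof.
case: c => [a|] sp sq /=; first by rewrite hornerM.
have lt_m : (m < (m + n).+1)%N by rewrite ltnS leq_addr.
rewrite coefM (bigD1 (Ordinal lt_m)) //= addKn big1 ?addr0 // => i.
rewrite -val_eqE /= neq_ltn => /orP[lt_i|gt_i]; last first.
  by rewrite (nth_default _ (leq_trans sp gt_i)) mul0r.
rewrite [q`__]nth_default ?mulr0 //; apply: leq_trans sq _.
by rewrite ltn_subRL ltn_add2r.
Qed.

Lemma size_prod_plin (I : finType) (f : I -> option F) (B : {set I}) :
  (size (\prod_(i in B) plin (f i))%R <= #|B|.+1)%N.
Proof.
rewrite -big_enum cardE; elim: (enum B) => [|i s IHs] /=.
  by rewrite big_nil size_poly1.
rewrite big_cons; apply: leq_trans (size_polyMleq _ _) _.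
by have := leq_add (size_plin (f i)) IHs; case: (_ + _)%N.
Qed.

Lemma prod_plin_neq0 (I : finType) (f : I -> option F) (B : {set I}) :
  \prod_(i in B) plin (f i) != 0.
Proof. by apply/prodf_neq0 => i _; apply: plin_neq0. Qed.

Lemma pev_prod_plin (I : finType) (f : I -> option F) (B : {set I}) c :
  pev #|B| (\prod_(i in B) plin (f i)) c = \prod_(i in B) br (f i) c.
Proof.
have [n] := ubnP #|B|; elim: n B => // n IHn B ltBn.
have [->|[i iB]] := set_0Vmem B.
  by rewrite !big_set0 cards0; case: (c) => [a|] /=; rewrite ?hornerE ?coefE.
rewrite (big_setD1 i iB) [RHS](big_setD1 i iB) /= (cardsD1 i B) iB pevM ?size_plin ?size_prod_plin //.
by rewrite IHn //; move: ltBn; rewrite (cardsD1 i B) iB.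
Qed.

(** A finite zero splits off a linear factor. A zero at infinity kills the top coefficient, and the
    other points are then finite, where evaluation ignores the degree. *)
Lemma poly_eq0_of_pev (s : seq (option F)) p : uniq s -> (size p <= size s)%N ->
  {in s, forall c, pev (size s).-1 p c = 0} -> p = 0.
Proof.
elim: s p => [|c s IHs] p /=; first by rewrite leqn0 size_poly_eq0 => _ /eqP.
case/andP=> cNs us sp p0.
have := p0 c (mem_head _ _); case: c cNs p0 => [a|] cNs p0 /= pa0.
  have /factor_theorem[q Eq] : root p a by apply/eqP.
  have sq : (size q <= size s)%N.
    have [->|q0] := eqVneq q 0; first by rewrite size_poly0.
    by move: sp; rewrite Eq size_Mmonic ?monicXsubC // size_XsubC addn2.
  rewrite Eq (IHs q) ?mul0r // => d ds.
  have := p0 d; rewrite inE ds orbT => /(_ isT)/eqP.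
  have ss : (0 < size s)%N by case: (s) ds.
  rewrite -{1}(prednK ss) Eq -addn1 (@pevM _ _ _ ('X - a%:P)) ?prednK //.
    by rewrite mulf_eq0 (br_eq0 (Some a)) => /orP[/eqP|/eqP Ed] //;
       rewrite Ed ds in cNs.
  by rewrite size_XsubC.
apply: IHs => //.
  by move: sp; rewrite leq_eqVlt => /orP[/eqP Es|//]; move: pa0;
    rewrite -[size s]/((size s).+1.-1) -Es -lead_coefE => /eqP;
    rewrite lead_coef_eq0 => /eqP p00; move: Es; rewrite p00 size_poly0.
move=> [b|] ds; last by rewrite ds in cNs.
by have := p0 (Some b); rewrite inE ds orbT => /(_ isT).
Qed.

(** Lagrange interpolation at the nodes [U]. The weights depend on [c] but not on [p], so two
    interpolations can be nested. *)
Lemma pev_interpolation (I : finType) (f : I -> option F) (U : {set I}) n c :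
  {in U &, injective f} -> #|U| = n.+1 ->
  exists w : I -> F, forall p, (size p <= n.+1)%N ->
    pev n p c = \sum_(u in U) w u * pev n p (f u).
Proof.
move=> f_inj cU; pose L u := \prod_(v in U :\ u) plin (f v).
have cUu u : u \in U -> #|U :\ u| = n.
  by move=> uU; move: cU; rewrite (cardsD1 u) uU => -[].
have sL u : u \in U -> (size (L u) <= n.+1)%N.
  by move=> uU; rewrite -(cUu u uU) size_prod_plin.
have LE u d : u \in U -> pev n (L u) d = \prod_(v in U :\ u) br (f v) d.
  by move=> uU; rewrite -(cUu u uU) pev_prod_plin.
have LN u : u \in U -> pev n (L u) (f u) != 0.
  move=> uU; rewrite LE //; apply/prodf_neq0 => v; rewrite !inE => /andP[vu vU].
  by rewrite br_eq0; apply: contra vu => /eqP/f_inj->.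
exists (fun u => pev n (L u) c / pev n (L u) (f u)) => p sp.
pose r := \sum_(u in U) (pev n p (f u) / pev n (L u) (f u)) *: L u.
have sr : (size r <= n.+1)%N.
  apply: (leq_trans (size_sum _ _ _)); apply/bigmax_leqP => u uU.
  exact: leq_trans (size_scale_leq _ _) (sL u uU).
suff /eqP : p - r = 0.
  rewrite subr_eq0 => /eqP {1}->; rewrite pev_sum; apply: eq_bigr => u uU.
  by rewrite pevZ; ring.
apply: (@poly_eq0_of_pev [seq f u | u <- enum U]).
- rewrite map_inj_in_uniq ?enum_uniq // => u v; rewrite !mem_enum; exact: f_inj.
- rewrite size_map -cardE cU (leq_trans (size_polyD _ _)) // size_polyN geq_max sp //.
move=> _ /mapP[u + ->]; rewrite mem_enum => uU.
rewrite size_map -cardE cU /= pevB pev_sum (bigD1 u) //= big1 => [|v].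
  by rewrite pevZ divfK ?LN // addr0 subrr.
case/andP=> vU vu; rewrite pevZ (LE v (f u)) // [X in _ * X](big_setD1 u) /= ?inE ?uU ?andbT 1?eq_sym //.
by have /eqP-> : br (f u) (f u) == 0 by [rewrite br_eq0]; rewrite mul0r mulr0.
Qed.

Lemma exists_subset_card (I : finType) (B : {set I}) n : (n <= #|B|)%N ->
  exists2 C : {set I}, C \subset B & #|C| = n.
Proof.
move=> nB; have : (0 < #|[set C : {set I} | C \subset B & #|C| == n]|)%N.
  by rewrite cards_draws bin_gt0.
by case/card_gt0P=> C; rewrite inE => /andP[CB /eqP cC]; exists C.
Qed.

(** The bound [2 * t + 3] makes room for [x] and two disjoint sets of [t + 1] nodes; disjointness
    keeps each pair of nodes off the diagonal, where antisymmetry is available. *)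
Lemma antisymmetric_pev_diag (I : finType) (f : I -> option F) (T : {set I}) t
    (p : I -> {poly F}) x :
  (2%:R != 0 :> F) -> {in T &, injective f} -> (2 * t + 3 <= #|T|)%N ->
  {in T, forall y, size (p y) <= t.+1}%N ->
  {in T &, forall y z, y != z -> pev t (p y) (f z) = - pev t (p z) (f y)} ->
  x \in T -> pev t (p x) (f x) = 0.
Proof.
move=> F2 f_inj cT sp pA xT.
have cTx : (2 * t + 2 <= #|T :\ x|)%N.
  by move: cT; rewrite (cardsD1 x T) xT; lia.
have [|U UT cU] := @exists_subset_card _ (T :\ x) t.+1.
  by lia.
have [|V VT cV] := @exists_subset_card _ (T :\ x :\: U) t.+1.
  by rewrite cardsDS // cU; lia.
have UP u : u \in U -> u \in T /\ u != x.
  by move/(subsetP UT); rewrite !inE => /andP[].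
have VP v : v \in V -> [/\ v \in T, v != x & v \notin U].
  by move/(subsetP VT); rewrite !inE => /and3P[].
have [|w wP] := @pev_interpolation _ f U t (f x) _ cU.
  by move=> u v /UP[uT _] /UP[vT _]; apply: f_inj.
have [|w' wP'] := @pev_interpolation _ f V t (f x) _ cV.
  by move=> u v /VP[uT _ _] /VP[vT _ _]; apply: f_inj.
suff /eqP : pev t (p x) (f x) = - pev t (p x) (f x).
  rewrite -addr_eq0 -mulr2n -mulr_natl mulf_eq0 (negPf F2).
  by move/eqP.
(* Expanding along [U] and then [V] uses antisymmetry twice and gives this sum; the other order uses
   it once and gives the opposite. *)
transitivity (\sum_(u in U) \sum_(v in V) w u * w' v * pev t (p v) (f u)).
  rewrite wP ?sp //; apply: eq_bigr => u uU; have [uT ux] := UP u uU.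
  rewrite pA 1?eq_sym // (wP' (p u)) ?sp // -sumrN mulr_sumr.
  apply: eq_bigr => v vV; have [vT _ vU] := VP v vV.
  have uv : u != v by apply: contraNneq vU => <-.
  by rewrite (pA u v) //; ring.
rewrite exchange_big /= wP' ?sp // -sumrN; apply: eq_bigr => v vV.
have [vT vx vU] := VP v vV.
rewrite [pev t (p x) _]pA 1?eq_sym // (wP (p v)) ?sp // mulrN opprK mulr_sumr.
by apply: eq_bigr => u _; ring.
Qed.

(** Wilson's theorem: compare the constant terms of [X^(q-1) - 1] and its factorization, where
    [q - 1] is even. *)
Lemma prod_finField_nonzero : odd #|F| -> \prod_(a : F | a != 0) a = -1.
Proof.
move=> oddF; have q0 : #|F| = #|F|.-1.+1 by case: #|F| oddF.
have E : \prod_(a : F | a != 0) ('X - a%:P) = 'X^(#|F|.-1) - 1 :> {poly F}.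
  apply: (mulfI (negbT (polyX_eq0 F))).
  rewrite mulrBr mulr1 -exprS -q0 finField_genPoly [RHS](bigD1 0) //=.
  by rewrite subr0.
have Q1 : #|[pred a : F | a != 0]| = #|F|.-1.
  by rewrite -(cardC1 (0 : F)); apply: eq_card.
have q1 : odd #|F|.-1 = false by move: oddF; rewrite q0 /=; case: odd.
have q2 : (0 < #|F|.-1)%N by have := finRing_gt1 F; rewrite q0 ltnS.
have /(congr1 (fun p => p.[0])) := E.
rewrite horner_prod !hornerE expr0n -leqn0 leqNgt q2 /= sub0r => <-.
under [RHS]eq_bigr => a _ do rewrite !hornerE.
by rewrite prodrN Q1 -signr_odd q1 expr0 mul1r.
Qed.

(* [c |-> br c y / br c z] maps the remaining points of the projective line
   bijectively onto the nonzero scalars. *)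
Lemma prod_br_ratio (y z : option F) : odd #|F| -> y != z ->
  \prod_(c in ~: [set y; z]) (br c y / br c z) = -1.
Proof.
move=> oddF yz; have nz c : c \in ~: [set y; z] -> br c y != 0 /\ br c z != 0.
  by rewrite !inE negb_or !br_eq0 => /andP[].
have g_inj : {in ~: [set y; z] &, injective (fun c => br c y / br c z)}.
  move=> c d /nz[cy cz] /nz[dy dz] /eqP; rewrite eqr_div // -subr_eq0.
  by rewrite br_plucker mulf_eq0 !br_eq0 (negPf yz) orbF => /eqP.
rewrite -(big_imset id g_inj) /= -prod_finField_nonzero //; apply: eq_bigl.
apply/subset_cardP; last first.
  by apply/subsetP=> _ /imsetP[c /nz[cy cz] ->]; rewrite unfold_in mulf_neq0 ?invr_eq0.
rewrite card_in_imset // cardsCs setCK cards2 yz card_option subSS subn1.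
by rewrite -(cardC1 (0 : F)); apply: eq_card.
Qed.

Lemma odd_finField_two_neq0 : odd #|F| -> 2%:R != 0 :> F.
Proof.
move=> oddF; apply/negP => F2.
have /eqP : #|F|%:R = 0 :> F.
  have := expg_cardG (in_setT (1%R : F)).
  by rewrite cardsT FinRing.zmodXgE.
rewrite -(odd_double_half #|F|) oddF natrD -mul2n natrM (eqP F2) mul0r addr0.
by rewrite oner_eq0.
Qed.
End BinaryForms.

(** * Pencils of hyperplanes and the tangents of an arc *)

Section ArcWithRationalPoints.
Local Open Scope ring_scope.
Variables (F : finFieldType) (X : finType) (k : nat) (rep : X -> 'rV[F]_k).
Variables (A G : {set X}) (par : X -> option F).
Implicit Types (B D : {set X}) (u x y z : X) (p : {poly F}) (c : option F).

(** Hyperplanes are encoded by polynomials of size at most [k], so that at a point of the curve the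
    linear equation becomes, up to a scalar, evaluation at the parameter. *)
Definition form u (p : {poly F}) : F := \sum_(i < k) p`_i * rep u 0 i.

Hypothesis arcA : forall p, p != 0 -> (size p <= k)%N ->
  (#|[set u in A | form u p == 0%R]| < k)%N.
Hypothesis GA : G \subset A.
Hypothesis par_inj : {in G &, injective par}.
Hypothesis formG : forall u p, u \in G -> (size p <= k)%N ->
  (form u p == 0) = (pev k.-1 p (par u) == 0).

(** For [k - 1] points of [G] this is the hyperplane that they span. *)
Definition secant B : {poly F} := \prod_(a in B) plin (par a).

(* The hyperplanes through [B] are the zero sets of [secant B * plin c];
   [pencil B u] is the parameter [c] of the one containing [u]. *)
Definition pencil B u : option F :=
  if form u (secant B) == 0 then None
  else Some (form u (secant B * 'X) / form u (secant B)).

(** For [k - 2] points of [G], these are the hyperplanes through [B] meeting [A] in [B] alone. *)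
Definition tangents B : {set option F} := ~: (pencil B @: (A :\: B)).

Definition tangent_form B : {poly F} := \prod_(c in tangents B) plin c.

Lemma formB u p q : form u (p - q) = form u p - form u q.
Proof.
by rewrite /form -sumrB; apply: eq_bigr => i _; rewrite coefB mulrBl.
Qed.

Lemma formZ u a p : form u (a *: p) = a * form u p.
Proof.
by rewrite /form mulr_sumr; apply: eq_bigr => i _; rewrite coefZ mulrA.
Qed.

Lemma secantU1 B x : x \notin B -> secant (x |: B) = secant B * plin (par x).
Proof. by move=> xB; rewrite /secant big_setU1 //= mulrC. Qed.

(** The left side is linear in [plin c], hence proportional to evaluation at its zero. The factor
    [e] does not depend on [c] and cancels in later ratios. *)
Lemma form_pencil B u : exists e, forall c,
  form u (secant B * plin c) = e * br c (pencil B u).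
Proof.
pose m := form u (secant B); pose n := form u (secant B * 'X).
exists (if m == 0 then n else m) => c.
have -> : form u (secant B * plin c) = if c is Some a then n - a * m else - m.
  case: c => [a|] /=.
    by rewrite mulrBr [_ * a%:P]mulrC mul_polyC formB formZ.
  by rewrite mulrN1 -[- _]add0r formB -(scale0r 0) formZ mul0r sub0r.
rewrite /pencil -/m -/n brE; case: (eqVneq m 0) => [->|m0]; case: c => [a|]; field.
all: by rewrite ?m0.
Qed.

Lemma form_secant_in B b p :
  B \subset G -> b \in B -> (size p <= k - #|B|)%N -> (#|B| < k)%N ->
  form b (secant B * p) = 0.
Proof.
move=> BG bB sp Bk; apply/eqP; rewrite formG ?(subsetP BG) //; last first.
  apply: leq_trans (size_polyMleq _ _) _.
  have := size_prod_plin par B; rewrite -/(secant B); lia.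
have -> : k.-1 = (#|B| + (k - #|B|).-1)%N by lia.
rewrite pevM ?size_prod_plin ?prednK ?subn_gt0 // pev_prod_plin.
rewrite (big_setD1 b) //= mulf_eq0 mulf_eq0.
by have -> : br (par b) (par b) == 0 by rewrite br_eq0.
Qed.

Lemma form_secant_neq0 B u : B \subset G -> #|B|.+1 = k -> u \in A :\: B ->
  form u (secant B) != 0.
Proof.
move=> BG cB; rewrite inE => /andP[uB uA]; apply/negP => /eqP f0.
have := @arcA _ (prod_plin_neq0 par B).
rewrite -{1}cB size_prod_plin => /(_ isT).
apply/negP; rewrite -leqNgt -cB.
have -> : #|B|.+1 = #|u |: B| by rewrite cardsU1 uB.
apply: subset_leq_card; apply/subsetP => v; rewrite !inE => /predU1P[->|vB].
  by rewrite uA; apply/eqP.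
rewrite (subsetP GA) ?(subsetP BG) //=; apply/eqP.
by have := @form_secant_in B v 1 BG vB; rewrite mulr1; apply; rewrite ?size_poly1; lia.
Qed.

(** Two points of [A] outside [B] on one hyperplane through [B] would give it [k] points of [A]. *)
Lemma pencil_inj B : B \subset G -> #|B|.+2 = k ->
  {in A :\: B &, injective (pencil B)}.
Proof.
move=> BG cB u v uAB vAB puv; apply/eqP/negPn/negP => uv.
move: uAB vAB; rewrite !inE => /andP[uB uA] /andP[vB vA].
pose c := pencil B u; have := @arcA (secant B * plin c).
rewrite mulf_neq0 ?plin_neq0 ?prod_plin_neq0 // => /(_ isT).
have -> : (size (secant B * plin c)%R <= k)%N.
  apply: leq_trans (size_polyMleq _ _) _.
  have := size_prod_plin par B; rewrite -/(secant B).
  have := size_plin c; lia.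
move=> /(_ isT); apply/negP; rewrite -leqNgt -cB.
have -> : #|B|.+2 = #|u |: (v |: B)|.
  by rewrite !cardsU1 !inE negb_or uv uB vB.
have on_c w : pencil B w = c -> form w (secant B * plin c) == 0.
  by have [e ->] := form_pencil B w; move=> ->; rewrite mulf_eq0 br_eq0 eqxx orbT.
apply: subset_leq_card; apply/subsetP => w; rewrite !inE => /or3P[/eqP->|/eqP->|wB].
- by rewrite uA on_c.
- by rewrite vA on_c.
rewrite (subsetP GA) ?(subsetP BG) //=; apply/eqP; apply: form_secant_in => //.
  by rewrite -cB -addn2 addKn size_plin.
by lia.
Qed.

Lemma card_tangents B : B \subset G -> #|B|.+2 = k ->
  #|tangents B| = (#|F|.+1 - (#|A| - #|B|))%N.
Proof.
move=> BG cB; rewrite cardsCs setCK card_option card_in_imset ?cardsDS //.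
  exact: subset_trans BG GA.
exact: pencil_inj.
Qed.

(** The case without a degree [k - 3]: with [B] empty, [pencil] embeds [A] into the projective
    line. *)
Lemma arc_card_le : k = 2%N -> (#|A| <= #|F|.+1)%N.
Proof.
move=> k2; have := @pencil_inj set0 (sub0set _); rewrite cards0 k2 setD0.
by move=> /(_ erefl) /card_in_imset <-; rewrite -card_option max_card.
Qed.

Lemma tangent_form_eq0 B c : (pev #|tangents B| (tangent_form B) c == 0) =
  (c \in tangents B).
Proof.
rewrite pev_prod_plin; apply/idP/idP => [|ct].
  by case/prodf_eq0=> d dt; rewrite br_eq0 => /eqP <-.
by apply/prodf_eq0; exists c; rewrite ?br_eq0.
Qed.

(** The second point [z] serves to show that the factor from [form_pencil] is nonzero: [y] is not on
    the hyperplane spanned by [z] and [B]. *)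
Lemma pencil_par B y z : B \subset G -> #|B|.+2 = k ->
  y \in G :\: B -> z \in G :\: B -> y != z -> pencil B y = par y.
Proof.
move=> BG cB; rewrite !inE => /andP[yB yG] /andP[zB zG] yz.
have [e eE] := form_pencil B y.
have : form y (secant (z |: B)) != 0.
  apply: form_secant_neq0; rewrite ?subUset ?sub1set ?zG ?cardsU1 ?zB //.
  by rewrite !inE negb_or yz yB (subsetP GA).
rewrite secantU1 // eE mulf_eq0 negb_or => /andP[e0 _].
have : form y (secant (y |: B) * 1) = 0.
  apply: form_secant_in; rewrite ?subUset ?sub1set ?yG ?cardsU1 ?yB ?setU11 //.
    by rewrite size_poly1; lia.
  by lia.
rewrite mulr1 secantU1 // eE => /eqP; rewrite mulf_eq0 (negPf e0) br_eq0.
by move/eqP.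
Qed.

(** Apply [prod_br_ratio] to the pencil on [B]: apart from the hyperplanes through [y] and [z], each
    member is a tangent or contains exactly one point of [A']. *)
Lemma tangent_form_ratio B y z : odd #|F| -> B \subset G -> #|B|.+2 = k ->
  y \in G :\: B -> z \in G :\: B -> y != z ->
  let n := #|tangents B| in let A' := A :\: (y |: (z |: B)) in
  pev n (tangent_form B) (par y) * \prod_(u in A') form u (secant (y |: B)) =
  - (pev n (tangent_form B) (par z) * \prod_(u in A') form u (secant (z |: B))).
Proof.
move=> oddF BG cB yGB zGB yz n A'.
have py := pencil_par BG cB yGB zGB yz.
have pz := @pencil_par B z y BG cB zGB yGB; rewrite eq_sym yz in pz.
have {}pz := pz isT.
move: (yGB) (zGB); rewrite !inE => /andP[yB yG] /andP[zB zG].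
have A'B u : u \in A' -> u \in A :\: B.
  by rewrite !inE !negb_or => /andP[/and3P[_ _ ->]].
have tNy c : c \in tangents B -> c \notin [set par y; par z].
  rewrite !inE => ct; apply: contra ct; case/orP=> /eqP->.
    by rewrite -py imset_f // !inE yB (subsetP GA).
  by rewrite -pz imset_f // !inE zB (subsetP GA).
have pyz : par y != par z by apply: contra yz => /eqP/par_inj->.
have cover : ~: [set par y; par z] = tangents B :|: pencil B @: A'.
  apply/setP => c; rewrite in_setC [RHS]in_setU.
  have [/tNy->//|/=] := boolP (c \in tangents B).
  rewrite inE negbK => /imsetP[u]; rewrite !inE => /andP[uB uA] ->{c}.
  rewrite -py -pz; have uAB : u \in A :\: B by rewrite inE uB.
  have inj v : v \in G :\: B -> (pencil B u == pencil B v) = (u == v).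
    rewrite inE => /andP[vB vG]; apply/eqP/eqP => [|->//].
    by apply: pencil_inj => //; rewrite inE vB (subsetP GA).
  rewrite !inj //; apply/idP/imsetP => [uyz|[v vA' puv]].
    by exists u; rewrite // !inE !orbA negb_or uyz uB.
  rewrite (pencil_inj BG cB uAB (A'B _ vA') puv).
  by move: vA'; rewrite !inE !negb_or => /andP[/and3P[-> ->]].
have dis : [disjoint tangents B & pencil B @: A'].
  rewrite disjoint_sym disjoints_subset setCK imsetS //; exact/subsetP.
have := prod_br_ratio oddF pyz.
rewrite (eq_bigl [in [predU tangents B & pencil B @: A']]); last first.
  by move=> c; rewrite cover in_setU.
rewrite bigU //=.
rewrite big_imset /=; last first.
  by move=> u v /A'B uAB /A'B; apply: pencil_inj.
rewrite big_split /= prodfV -!pev_prod_plin -/(tangent_form B) -/n.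
(* The factor [e] cancels in each quotient, and so do the two signs from swapping the arguments of
   [br]. *)
have -> : \prod_(u in A') (br (pencil B u) (par y) / br (pencil B u) (par z)) =
  \prod_(u in A') (form u (secant (y |: B)) / form u (secant (z |: B))).
  apply: eq_bigr => u uA'; rewrite !secantU1 //; have [e eE] := form_pencil B u.
  have : form u (secant (z |: B)) != 0.
    apply: form_secant_neq0; rewrite ?subUset ?sub1set ?zG ?cardsU1 ?zB //.
    by move: uA'; rewrite !inE !negb_or => /andP[/and3P[_ -> ->]].
  rewrite secantU1 // !eE mulf_eq0 negb_or => /andP[e0 _].
  by rewrite -mulf_div divff // mul1r ![br (par _) _]brC mulNr invrN mulrN opprK.
rewrite big_split /= prodfV.
have t0 : pev n (tangent_form B) (par z) != 0.
  rewrite tangent_form_eq0; apply/negP => /tNy.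
  by rewrite !inE eqxx orbT.
have f0 : \prod_(u in A') form u (secant (z |: B)) != 0.
  apply/prodf_neq0 => u uA'.
  apply: form_secant_neq0; rewrite ?subUset ?sub1set ?zG ?cardsU1 ?zB //.
  by move: uA'; rewrite !inE !negb_or => /andP[/and3P[_ -> ->]].
by rewrite mulf_div => /(canRL (divfK (mulf_neq0 t0 f0))) ->; rewrite mulN1r.
Qed.

(** Multiply the ratio identities for [D] extended by [x], by [y] and by [z]. The products [W a b]
    are symmetric in [a] and [b], so they cancel, and the three signs leave one minus. *)
Lemma segre_lemma_of_tangents D n x y z : odd #|F| -> D \subset G ->
  #|D|.+3 = k -> n = (#|F|.+2 - (#|A| - #|D|))%N ->
  x \in G :\: D -> y \in G :\: D -> z \in G :\: D -> x != y -> y != z -> z != x ->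
  let H a b := pev n (tangent_form (a |: D)) (par b) in
  H x y * H y z * H z x = - (H x z * H z y * H y x).
Proof.
move=> oddF DG cD nE xGD yGD zGD xy yz zx H.
pose A' := A :\: (x |: (y |: (z |: D))).
pose W a b := \prod_(u in A') form u (secant (a |: (b |: D))).
have cU a : a \in G :\: D ->
    [/\ a |: D \subset G, #|a |: D|.+2 = k & #|tangents (a |: D)| = n].
  rewrite inE => /andP[aD aG].
  have aDG : a |: D \subset G by rewrite subUset sub1set aG.
  have caD : #|a |: D|.+2 = k by rewrite cardsU1 aD.
  split=> //; rewrite card_tangents // nE.
  have := subset_leq_card (subset_trans aDG GA).
  by rewrite cardsU1 aD; clear; lia.
have ratio a b (c : X) : a \in G :\: D -> b \in G :\: D -> c \in G :\: D ->
    a != b -> b != c -> c != a -> A' = A :\: (b |: (c |: (a |: D))) ->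
    H a b * W a b = - (H a c * W a c).
  move=> aGD bGD cGD ab bc ca EA'; have [aDG caD ctan] := cU a aGD.
  have := @tangent_form_ratio (a |: D) b c oddF aDG caD.
  rewrite /= ctan -EA' /W !(setUCA [set a]); apply=> //.
    by move: bGD; rewrite !inE negb_or eq_sym ab.
  by move: cGD; rewrite !inE negb_or ca.
have WC a b : W a b = W b a by rewrite /W setUCA.
have W0 a b (c : X) : a \in G :\: D -> b \in G :\: D -> a != b ->
    A' = A :\: (a |: (b |: (c |: D))) -> W a b != 0.
  rewrite /W !inE => /andP[aD aG] /andP[bD bG] ab ->.
  apply/prodf_neq0 => u; rewrite !inE !negb_or => /andP[/and4P[ua ub uc uD] uA].
  apply: form_secant_neq0.
  - by rewrite !subUset !sub1set aG bG.
  - by rewrite !cardsU1 !inE negb_or ab aD bD.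
  by rewrite !inE !negb_or ua ub uD.
have E1 := ratio x y z xGD yGD zGD xy yz zx.
have E2 := ratio y z x yGD zGD xGD yz zx xy.
have E3 := ratio z x y zGD xGD yGD zx xy yz.
have S1 : A' = A :\: (y |: (z |: (x |: D))).
  by rewrite /A' (setUCA [set x]) (setUCA [set x]).
have S2 : A' = A :\: (z |: (x |: (y |: D))).
  by rewrite /A' (setUCA [set z]) (setUCA [set z]).
have {}E1 := E1 S1; have {}E2 := E2 S2; have {}E3 := E3 erefl.
have Wxy : W x y != 0 by apply: W0 erefl.
have Wyz : W y z != 0 by apply: W0 S1.
have Wzx : W z x != 0 by apply: W0 S2.
have Wnz : W x y * W y z * W z x != 0 by rewrite !mulf_neq0.
apply: (mulIf Wnz); rewrite (WC y x) in E2; rewrite (WC x z) in E1.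
rewrite (WC z y) in E3.
transitivity ((H x y * W x y) * (H y z * W y z) * (H z x * W z x)); first by ring.
by rewrite E1 E2 E3; ring.
Qed.

(** The bound [3 * n + 3] counts [n] points for [D] and the [2 * n + 3] points outside it that
    [antisymmetric_pev_diag] requires. *)
Lemma arc_size_neq n : k = n.+3 -> odd #|F| -> (3 * n + 3 <= #|G|)%N ->
  #|A| <> #|F|.+2.
Proof.
move=> kE oddF cG cA.
have [|B BG cB] := @exists_subset_card _ G n.+1; first by lia.
have tB : #|tangents B| = n.
  rewrite card_tangents ?cB ?cA //; have := subset_leq_card GA.
  by rewrite cA; lia.
suff BT : par @: B \subset tangents B.
  have := subset_leq_card BT; rewrite tB card_in_imset ?cB ?ltnn //.
  by move=> u v uB vB; apply: par_inj; apply: (subsetP BG).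
apply/subsetP=> _ /imsetP[x xB ->]; rewrite -tangent_form_eq0 tB.
have EB := setD1K xB; set D := B :\ x in EB.
have DG : D \subset G by rewrite (subset_trans _ BG) // subD1set.
have cD : #|D| = n by move: cB; rewrite (cardsD1 x) xB => -[].
have xD : x \in G :\: D by rewrite !inE eqxx (subsetP BG).
(* Keeps the truncated subtraction [q + 2 - (q + 2 - n)] equal to [n]. *)
have nF : (n <= #|F|.+2)%N.
  by rewrite -cA -cD subset_leq_card // (subset_trans DG).
clearbody D; pose H a b := pev n (tangent_form (a |: D)) (par b).
have tD a : a \in G :\: D -> #|tangents (a |: D)| = n.
  rewrite inE => /andP[aD aG]; rewrite card_tangents ?cardsU1 ?aD ?cD //.
    by rewrite cA; have := subset_leq_card GA; lia.
  by rewrite subUset sub1set aG.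
have H0 a b : a \in G :\: D -> b \in G :\: D -> a != b -> H a b != 0.
  move=> aGD bGD ab; rewrite /H -(tD a aGD) tangent_form_eq0.
  move: (aGD) (bGD); rewrite !inE => /andP[aD aG] /andP[bD bG].
  have aDG : a |: D \subset G by rewrite subUset sub1set aG.
  have caD : #|a |: D|.+2 = k by rewrite cardsU1 aD cD.
  (* The auxiliary point demanded by [pencil_par]; it exists since [n + 2 < 3 * n + 3]. *)
  have [e] : exists e, e \in G :\: (b |: (a |: D)).
    apply/set0Pn; rewrite -card_gt0 cardsDS; last by rewrite subUset sub1set bG.
    by rewrite cardsU1 (cardsU1 a) aD cD; case: (b \notin _); clear - cG; lia.
  rewrite !inE !negb_or => /andP[/and3P[eb ea eD] eG].
  rewrite negbK; apply/imsetP; exists b.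
    by rewrite !inE negb_or eq_sym ab bD (subsetP GA).
  apply/esym; apply: (@pencil_par _ b e) => //; rewrite ?inE ?negb_or.
  - by rewrite eq_sym ab bD.
  - by rewrite ea eD.
  by rewrite eq_sym.
(* The scaling makes [H] antisymmetric on pairs containing [x], and then on all
   pairs by the lemma of tangents. *)
pose s a := if a == x then 1 else - H x a / H a x.
have sH a b : a \in G :\: D -> b \in G :\: D -> a != b ->
    s a * H a b = - (s b * H b a).
  move=> aGD bGD ab; rewrite /s.
  case: (eqVneq a x) => [Ea|ax]; first rewrite Ea in ab aGD *.
    by rewrite eq_sym (negPf ab); field; rewrite H0 // eq_sym.
  case: (eqVneq b x) => [Eb|bx]; first rewrite Eb in ab bGD *.
    by field; rewrite H0.
  have Hab := @segre_lemma_of_tangents D n x a b oddF DG.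
  rewrite /= cD kE cA in Hab.
  have {}Hab : H x a * H a b * H b x = - (H x b * H b a * H a x).
    by apply: Hab => //; [rewrite subKn | rewrite eq_sym].
  have ax0 := H0 a x aGD xD ax; have bx0 := H0 b x bGD xD bx.
  apply: (mulIf (mulf_neq0 ax0 bx0)).
  transitivity (- (H x a * H a b * H b x)); first by field.
  by rewrite Hab; field.
have := @antisymmetric_pev_diag _ _ par (G :\: D) n
  (fun a => s a *: tangent_form (a |: D)) x.
rewrite pevZ /s eqxx mul1r EB => ->//.
- exact: odd_finField_two_neq0.
- by move=> u v; rewrite !inE => /andP[_ uG] /andP[_ vG]; apply: par_inj.
- by rewrite cardsDS // cD; lia.
- move=> a aGD; apply: leq_trans (size_scale_leq _ _) _.
  by rewrite -(tD a aGD) size_prod_plin.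
by move=> a b aGD bGD ab; rewrite !pevZ; exact: sH.
Qed.

End ArcWithRationalPoints.

(** * From points of the projective space to coordinates and parameters *)

Section ProjectivePoints.
Local Open Scope ring_scope.
Variables (F : finFieldType) (k : nat) (g : 'M[F]_k).
Hypothesis g_unit : g \in unitmx.
Implicit Types (P : pg_point F k) (A : {set pg_point F k}) (p : {poly F}).

Definition pg_rep P : 'rV[F]_k := vpick (pg_line P) *m invmx g.

(** The default [None] is reached only off the curve, where it does not mean infinity. *)
Definition nrc_param P : option F :=
  odflt None [pick t | pg_line P == <[nrc_vec k t *m g]>%VS].

Lemma pg_lineE P : pg_line P = <[vpick (pg_line P)]>%VS.
Proof.
apply/esym/eqP; rewrite eqEdim -memvE memv_pick dim_vline vpick0.
by rewrite -dimv_eq0 (eqP (pg_line_dim P)).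
Qed.

Lemma nrc_paramP P : P \in nrc_of g ->
  pg_line P = <[nrc_vec k (nrc_param P) *m g]>%VS.
Proof.
rewrite inE /nrc_param => /existsP[t Pt]; case: pickP => [s /eqP//|/(_ t)].
by rewrite Pt.
Qed.

Lemma nrc_param_inj : {in nrc_of g &, injective nrc_param}.
Proof.
by move=> P Q /nrc_paramP EP /nrc_paramP EQ E; apply: val_inj; rewrite /= EP EQ E.
Qed.

Lemma form_nrc_vec t p : (0 < k)%N -> (size p <= k)%N ->
  \sum_(i < k) p`_i * nrc_vec k t 0 i = pev k.-1 p t.
Proof.
move=> k0 sp; case: t => [a|] /=.
  by rewrite (horner_coef_wide _ sp); apply: eq_bigr => i _; rewrite mxE.
have lt_k : (k.-1 < k)%N by rewrite prednK.
rewrite (bigD1 (Ordinal lt_k)) //= mxE eqxx mulr1 big1 ?addr0 // => i.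
by rewrite -val_eqE /= mxE => /negPf->; rewrite mulr0.
Qed.

Lemma form_nrc P p : (0 < k)%N -> P \in nrc_of g -> (size p <= k)%N ->
  (form pg_rep P p == 0) = (pev k.-1 p (nrc_param P) == 0).
Proof.
move=> k0 /nrc_paramP EP sp.
have P0 : pg_line P != 0%VS by rewrite -dimv_eq0 (eqP (pg_line_dim P)).
have /vlineP[a Ea] : vpick (pg_line P) \in <[nrc_vec k (nrc_param P) *m g]>%VS.
  by rewrite -EP memv_pick.
have a0 : a != 0.
  by apply: contra P0 => /eqP a0; rewrite -vpick0 Ea a0 scale0r.
suff -> : form pg_rep P p = a * pev k.-1 p (nrc_param P).
  by rewrite mulf_eq0 (negPf a0).
rewrite -form_nrc_vec // mulr_sumr; apply: eq_bigr => i _.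
by rewrite /pg_rep Ea -scalemxAl mulmxK // mxE mulrCA.
Qed.

(** If [k] points of the arc were zeros, they would span the space, so the functional with
    coefficients [p] would vanish identically. *)
Lemma arc_form_zeros A p : is_arc A -> p != 0 -> (size p <= k)%N ->
  (#|[set P in A | form pg_rep P p == 0%R]| < k)%N.
Proof.
move=> arcA p0 sp; rewrite ltnNge; apply/negP => /exists_subset_card[S SA cS].
have SfA : S \subset A.
  by apply: subset_trans SA _; apply/subsetP=> P; rewrite inE => /andP[].
(* The functional [p], transported back to the original basis. *)
pose q := invmx g *m \col_(i < k) p`_i.
have vq (v : 'rV_k) : v *m q = 0.
  have : v \in (\sum_(P in S) pg_line P)%VS by rewrite arcA // memvf.
  case/memv_sumP=> w wS ->; rewrite mulmx_suml big1 // => P PS.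
  have [a ->] : exists a, w P = a *: vpick (pg_line P).
    by apply/vlineP; rewrite -pg_lineE wS.
  rewrite -scalemxAl; have /(subsetP SA) := PS; rewrite inE => /andP[_ /eqP fP].
  suff -> : vpick (pg_line P) *m q = 0 by rewrite scaler0.
  rewrite mulmxA; apply/matrixP=> i j; rewrite !ord1 [RHS]mxE -[RHS]fP mxE.
  by apply: eq_bigr => l _; rewrite !mxE mulrC.
have q0 : q = 0 by apply/row_matrixP=> i; rewrite rowE vq row0.
case/eqP: p0; apply/polyP=> i; rewrite coef0.
have [ki|ik] := leqP k i; first by rewrite nth_default // (leq_trans sp).
have /matrixP/(_ (Ordinal ik) 0) : \col_(j < k) p`_j = 0.
  by rewrite -[LHS](mulKVmx g_unit) -/q q0 mulmx0.
by rewrite !mxE.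
Qed.

End ProjectivePoints.

Theorem theorem1p4 (F : finFieldType) (q k : nat)
  (hF : #|F| = q) (hq : odd q) (hk : 2 <= k)
  (C : {set pg_point F k}) (hC : normal_rational_curve C)
  (S : {set pg_point F k}) (hSC : S \subset C) (hS : #|S| = 3 * k - 6) :
  ~ (exists A : {set pg_point F k}, [/\ is_arc A, #|A| = q + 2 & S \subset A]).
Proof.
case=> A [arcA cA SA]; case: hC hSC => g g_unit -> SC.
have arc_zeros p := @arc_form_zeros F k g g_unit A p arcA.
have par_inj : {in S &, injective (nrc_param g)}.
  by move=> P Q /(subsetP SC) PC /(subsetP SC); apply: nrc_param_inj.
have formS P (p : {poly F}) : P \in S -> size p <= k ->
    (form (pg_rep g) P p == 0%R) = (pev k.-1 p (nrc_param g P) == 0%R).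
  by move=> /(subsetP SC); apply: form_nrc => //; exact: ltnW.
(* For [k = 2] the set [S] is empty, and the bound on arcs of a line suffices. *)
have [k2|k3] := leqP k 2.
  have := arc_card_le arc_zeros SA formS; rewrite cA hF; lia.
apply: (@arc_size_neq _ _ _ _ _ _ _ arc_zeros SA par_inj formS (k - 3)).
all: rewrite ?hF ?hS ?cA //; lia.
Qed.
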